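(* Let $V$ be a set and let $F\subseteq\mathcal P(V)$ be such that $(F,\supseteq)$ is a rooted forest. Let $\mathcal F$ denote the set of connected components of $(F,\supseteq)$, and for every $T\in\mathcal F$ let $V_T$ denote the root of $(T,\supseteq)$. Then $F$ is a decision forest on $V$ if and only if both of the following hold: 1. $\{V_T\mid T\in\mathcal F\}$ is a partition of $V$; 2. for every $T\in\mathcal F$, $T$ is a decision tree on $V_T$.
   Context: In a poset $(N,\ge)$, $\uparrow x=\{y\in N\mid y\ge x\}$. A chain is a totally ordered subset; a maximal chain is a chain maximal with respect to inclusion. A poset $(F,\ge)$ is a forest iff every $\uparrow x$ is a chain; a forest is rooted iff $F\neq\emptyset$ and for every $x\in F$, $\uparrow x$ contains a maximal element of $(F,\ge)$. A tree is a forest with $(\uparrow x)\cap(\uparrow y)\ne\emptyset$ for all $x,y$. Every forest $(F,\ge)$ has a unique partition into trees such that $x\ge y$ implies that $x$ and $y$ lie in the same member; its members are the connected components. If the forest is rooted, each component has a maximum, called its root. A *decision forest on a set $V$* is a subset $F\subseteq\mathcal P(V)$ such that (1) $(F,\supseteq)$ is a rooted forest, and (2) if $W$ denotes the set of maximal chains of $(F,\supseteq)$ and $W(y)=\{w\in W\mid y\in w\}$ for $y\in F$, there is a bijection $f\colon V\to W$ such that $\{f(v)\mid v\in y\}=W(y)$ for every $y\in F$. It is a *decision tree on $V$* iff, in addition, for all $x,y\in F$ there is $z\in F$ with $z\supseteq x\cup y$. *)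

(* Defs.v *)
From mathcomp Require Export all_boot all_order.
From mathcomp Require Export boolp classical_sets functions.

Set Implicit Arguments.
Unset Strict Implicit.
Unset Printing Implicit Defensive.

Export Order.TTheory.

Local Open Scope classical_set_scope.

(** A poset [(N, >=)] is a subset [N : set X] of a [porderType] [X], ordered by
    the restriction of the order of [X].  For [X := set U] the library order is
    inclusion ([subsetEset]), so that [x <= y] in [X] is [y >= x] in the poset
    [(N, ⊇)]. *)

Definition upset d (X : porderType d) (N : set X) (x : X) : set X :=
  [set y | N y /\ (x <= y)%O].

Definition chain d (X : porderType d) (N c : set X) : Prop :=
  c `<=` N /\ total_on c (fun x y => (x <= y)%O).

Definition maximal_chains d (X : porderType d) (N : set X) : set (set X) :=
  [set c | chain N c /\ forall c', chain N c' -> c `<=` c' -> c' = c].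

Definition maximal_elt d (X : porderType d) (N : set X) (m : X) : Prop :=
  N m /\ forall y, N y -> (m <= y)%O -> y = m.

Definition forest d (X : porderType d) (F : set X) : Prop :=
  forall x, F x -> chain F (upset F x).

Definition rooted_forest d (X : porderType d) (F : set X) : Prop :=
  [/\ forest F, F !=set0 &
      forall x, F x -> exists2 m, upset F x m & maximal_elt F m].

Definition tree d (X : porderType d) (T : set X) : Prop :=
  forest T /\ forall x y, T x -> T y -> upset T x `&` upset T y !=set0.

Definition component_partition d (X : porderType d)
    (F : set X) (P : set (set X)) : Prop :=
  [/\ partition P id F,
      forall T, P T -> tree T &
      forall x y, F x -> F y -> (y <= x)%O -> exists2 T, P T & T x /\ T y].

(** For a forest [F] there is exactly one [P] with [component_partition F P]
    (lemmas [ex_component_partition] and [connected_componentsE] below), so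
    these are its members. *)
Definition connected_components d (X : porderType d) (F : set X)
    : set (set X) :=
  [set T | exists2 P, component_partition F P & P T].

Definition maximums d (X : porderType d) (T : set X) : set X :=
  T `&` ubound T.

(** [set0] is a junk value, returned when [(T, ⊇)] has no maximum; it never
    arises for a component of a rooted forest (lemma [tree_rootP] below). *)
Definition tree_root U (T : set (set U)) : set U := xget set0 (maximums T).

(** The underlying set [V] is a subset of a type [U], since the notion is also
    applied to the roots of the components, which are subsets of [V]. *)
Definition decision_forest U (V : set U) (F : set (set U)) : Prop :=
  [/\ forall y, F y -> y `<=` V,
      rooted_forest F &
      exists f : U -> set (set U),
        set_bij V (maximal_chains F) f /\
        forall y, F y -> f @` y = [set w | maximal_chains F w /\ w y]].

Definition decision_tree U (V : set U) (F : set (set U)) : Prop :=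
  decision_forest V F /\
  forall x y, F x -> F y -> exists2 z, F z & x `|` y `<=` z.

Lemma ex_component_partition d (X : porderType d) (F : set X) :
  forest F -> exists P, component_partition F P.
Proof.
move=> fF; pose conn x y := upset F x `&` upset F y !=set0.
have connxx x : F x -> conn x x by move=> Fx; exists x.
have connC x y : conn x y -> conn y x by case=> a [? ?]; exists a.
have conn_trans y x z : F y -> conn x y -> conn y z -> conn x z.
  move=> Fy [a [[Fa xa] ya]] [b [yb [Fb zb]]].
  have [_ /(_ a b ya yb)[ab|ba]] := fF y Fy.
    by exists b; split; split=> //; exact: le_trans xa ab.
  by exists a; split; split=> //; exact: le_trans zb ba.
pose cls x := [set y | F y /\ conn x y].
exists [set cls x | x in F]; split.
- split.
  + apply/seteqP; split=> [y [_ [x Fx <-] []//]|y Fy].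
    by exists (cls y); [exists y | split=> //; exact: connxx].
  + move=> _ _ [x Fx <-] [y Fy <-] [z [[Fz xz] [_ yz]]].
    have xy : conn x y by apply: (conn_trans z) => //; exact: connC.
    apply/seteqP; split=> t [Ft ct]; split=> //.
      by apply: (conn_trans x) => //; exact: connC.
    exact: (conn_trans y).
  + by move=> _ [x Fx <-]; exists x; split=> //; exact: connxx.
- move=> _ [x Fx <-]; split=> [y [Fy _]|y z [Fy xy] [Fz xz]].
    split=> [t []//|s t [[Fs _] ys] [[Ft _] yt]].
    by have [_ /(_ s t)] := fF y Fy; apply.
  have [a [[Fa ya] [_ za]]] : conn y z.
    by apply: (conn_trans x) => //; exact: connC.
  have xa : conn x a by apply: (conn_trans y) => //; exists a.
  by exists a.
- move=> x y Fx Fy yx; exists (cls x); first by exists x.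
  by split; split=> //; [exact: connxx | exists x].
Qed.

Lemma connected_componentsE d (X : porderType d) (F : set X) P :
  component_partition F P -> connected_components F = P.
Proof.
have sub P1 P2 T x y : component_partition F P1 -> component_partition F P2 ->
    P1 T -> T x -> T y -> forall T', P2 T' -> T' x -> T' y.
  move=> [[cP1 _ _] tP1 _] [[cP2 dP2 _] tP2 sP2] PT Tx Ty T' PT' T'x.
  have TF z : T z -> F z by move=> Tz; rewrite -cP1; exists T.
  have [_ /(_ x y Tx Ty)[a [[Ta xa] [_ ya]]]] := tP1 T PT.
  have [A PA [Aa Ax]] := sP2 a x (TF _ Ta) (TF _ Tx) xa.
  have [B PB [Ba By]] := sP2 a y (TF _ Ta) (TF _ Ty) ya.
  have <- : B = T'; last by [].
  have -> : B = A by apply: dP2 => //; exists a.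
  by apply: dP2 => //; exists x.
move=> cP; apply/seteqP; split=> [T [P' cP' P'T]|T PT]; last by exists P.
have [[cvP' _ /(_ T P'T)[x Tx]] _ _] := cP'.
have Fx : F x by rewrite -cvP'; exists T.
have [[cvP _ _] _ _] := cP.
have [T' PT' T'x] : cover P id x by rewrite cvP.
suff -> : T = T' by [].
by apply/seteqP; split=> y ?; [exact: (sub P' P T x y) | exact: (sub P P' T' x y)].
Qed.

Lemma tree_rootP U (F T : set (set U)) :
  rooted_forest F -> connected_components F T ->
  T (tree_root T) /\ forall x, T x -> x `<=` tree_root T.
Proof.
move=> [fF _ rF] [P [[cP dP nP] tP sP] PT].
suff [TR uR] : maximums T (tree_root T) by split=> // x /uR; rewrite subsetEset.
apply: xgetPex; have [x Tx] := nP _ PT.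
have TF z : T z -> F z by move=> Tz; rewrite -cP; exists T.
have same y z : T y -> F z -> (y <= z)%O -> T z.
  move=> Ty Fz yz; have [A PA [Az Ay]] := sP z y Fz (TF _ Ty) yz.
  by have <- : A = T by apply: dP => //; exists y.
have [m [Fm xm] [_ mm]] := rF x (TF _ Tx).
have Tm := same _ _ Tx Fm xm; exists m; split=> // y Ty.
have [_ /(_ m y Tm Ty)[a [[Ta ma] [_ ya]]]] := tP T PT.
by rewrite -(mm a (TF _ Ta) ma).
Qed.

(* Main.v *)
(** The bijection of a decision forest is forced: it must send [v] to the branch
    of the members of [F] containing [v].  The maximal chains of [F] are those
    of its components, and each maximal chain of a component contains the
    root.  So, once the roots partition [V], the branch of [v] in [F] is its
    branch in the one component whose root contains [v], and bijectivity can be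
    checked component by component. *)
Require Import Defs.

Local Open Scope classical_set_scope.

Section Posets.
Local Set Implicit Arguments.
Local Unset Strict Implicit.
Context d (X : porderType d).
Implicit Types (F N T c w : set X) (x y m : X).

Lemma chain_sub N1 N2 c : c `<=` N2 -> chain N1 c -> chain N2 c.
Proof. by move=> cN [_ tc]; split. Qed.

(** Adjoining [m] to [w] keeps it a chain, so maximality leaves no room for [m] outside [w]. *)
Lemma maximal_chain_mem N w m : maximal_chains N w -> N m ->
  (forall x, w x -> (x <= m)%O \/ (m <= x)%O) -> w m.
Proof.
move=> [[wN tw] maxw] Nm cmp.
have <- : w `|` [set m] = w; last by right.
apply: maxw; last by move=> x; left.
split=> [x [/wN//|->//]|x y [wx|->] [wy|->]].
- exact: tw.
- exact: cmp.
- by have [] := cmp y wy; [right | left].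
- by left.
Qed.

Lemma maximal_chain_neq0 N w : N !=set0 -> maximal_chains N w -> w !=set0.
Proof.
move=> [m Nm] mw; apply: contrapT => w0; case: (w0); exists m.
(* If [w] were empty, comparability with [m] would hold vacuously and force [m] into [w]. *)
by apply: maximal_chain_mem mw Nm _ => x wx; case: w0; exists x.
Qed.

(** Zorn's lemma applies because a union of nested chains is a chain. This later provides a point in
    every root. *)
Lemma ex_maximal_chain N : maximal_chains N !=set0.
Proof.
have [|w [cw maxw]] := @Zorn_bigcup X (chain N).
  move=> C CN tC; split=> [x [c /CN[cN _] /cN//]|x y [c Cc cx] [c' Cc' c'y]].
  have [cc'|c'c] := tC c c' Cc Cc'.
    by have [_] := CN c' Cc'; apply=> //; exact: cc'.
  by have [_] := CN c Cc; apply=> //; exact: c'c.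
exists w; split=> // c cc wc; apply: contrapT => cw'.
apply: (maxw c) => //; split=> // cw''; apply: cw'.
by apply/seteqP.
Qed.

Lemma connected_componentsP F :
  forest F -> component_partition F (connected_components F).
Proof.
by case/ex_component_partition=> P cP; rewrite (connected_componentsE cP).
Qed.

Lemma component_sub F T : forest F -> connected_components F T -> T `<=` F.
Proof.
move=> /connected_componentsP[[cF _ _] _ _] FT x Tx.
by rewrite -cF; exists T.
Qed.

Lemma ex_component F x : forest F -> F x ->
  exists2 T, connected_components F T & T x.
Proof. by move=> /connected_componentsP[[cF _ _] _ _]; rewrite -{1}cF. Qed.

Lemma component_uniq F T T' x : forest F ->
  connected_components F T -> connected_components F T' ->
  T x -> T' x -> T = T'.
Proof.
move=> /connected_componentsP[[_ dF _] _ _] FT FT' Tx T'x.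
by apply: dF => //; exists x.
Qed.

Lemma component_comparable F T x y : forest F -> connected_components F T ->
  T x -> F y -> (x <= y)%O \/ (y <= x)%O -> T y.
Proof.
move=> fF FT Tx Fy cmp; have Fx := component_sub fF FT Tx.
have [_ _ sF] := connected_componentsP fF.
have [A FA [Ax Ay]] : exists2 A, connected_components F A & A x /\ A y.
  case: cmp => [xy|yx]; last exact: sF.
  by have [A ? []] := sF _ _ Fy Fx xy; exists A.
by rewrite (component_uniq fF FT FA Tx Ax).
Qed.

End Posets.

Section RootedForests.
Local Set Implicit Arguments.
Local Unset Strict Implicit.
Context (U : Type).
Implicit Types (V : set U) (F T w : set (set U)).

Lemma component_rooted F T :
  rooted_forest F -> connected_components F T -> rooted_forest T.
Proof.
move=> rF FT; have [fF _ _] := rF.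
have [_ /(_ T FT)[fT _] _] := connected_componentsP fF.
have [TR TleR] := tree_rootP rF FT.
split=> // [|x Tx]; first by exists (tree_root T).
exists (tree_root T); first by split=> //; rewrite subsetEset; exact: TleR.
split=> // y Ty; rewrite subsetEset => Ry.
by apply/seteqP; split=> //; exact: TleR.
Qed.

(** Everything in [w] is comparable with [x], hence lies in [T] and below its root, so the root can
    be adjoined to [w]. *)
Lemma maximal_chain_root F T w x : rooted_forest F ->
  connected_components F T -> maximal_chains F w -> w x -> T x ->
  w (tree_root T).
Proof.
move=> rF FT mw wx Tx; have [fF _ _] := rF.
have [TR TleR] := tree_rootP rF FT; have [[wF tw] _] := mw.
apply: (maximal_chain_mem mw (component_sub fF FT TR)) => y wy.
left; rewrite subsetEset; apply: TleR.
by apply: (component_comparable fF FT Tx (wF _ wy)); exact: tw.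
Qed.

Lemma ex_maximal_chain_root F w : rooted_forest F -> maximal_chains F w ->
  exists2 T, connected_components F T & w (tree_root T).
Proof.
move=> rF mw; have [fF F0 _] := rF; have [[wF _] _] := mw.
have [x wx] := maximal_chain_neq0 F0 mw.
have [T FT Tx] := ex_component fF (wF _ wx).
by exists T => //; exact: (maximal_chain_root rF FT mw wx Tx).
Qed.

(** A chain of [F] through the root consists of elements comparable with the root, so it stays
    inside [T]. Among chains through the root, maximality in [F] and in [T] therefore agree. *)
Lemma maximal_chains_component F T : rooted_forest F ->
  connected_components F T ->
  maximal_chains T = [set w | maximal_chains F w /\ w (tree_root T)].
Proof.
move=> rF FT; have [fF _ _] := rF; have TF := component_sub fF FT.
have [TR TleR] := tree_rootP rF FT.
have chainT c : chain F c -> c (tree_root T) -> chain T c.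
  move=> [cF tc] cR; apply: (@chain_sub _ _ F) => // y cy.
  by apply: (component_comparable fF FT TR (cF _ cy)); exact: tc.
apply/seteqP; split=> w [].
  move=> cw maxw; have [wT _] := cw.
  have wR : w (tree_root T).
    apply: (@maximal_chain_mem _ _ T) => // x /wT Tx.
    by left; rewrite subsetEset; exact: TleR.
  split=> //; split=> [|c cc wc].
    by apply: chain_sub cw => x /wT /TF.
  by apply: maxw => //; apply: chainT => //; exact: wc.
move=> [cw maxw] wR; split=> [|c cc wc]; first exact: chainT.
have [cT _] := cc; apply: maxw => //; apply: chain_sub cc.
by move=> x /cT /TF.
Qed.

Definition branch F (v : U) : set (set U) := [set y | F y /\ y v].

(** If [y] is in [f v], then [f v] is the image of some point of [y], which is [v] by injectivity;
    hence [f] agrees with [branch F] on [V]. Conversely, surjectivity gives the image condition for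
    [branch F]. *)
Lemma decision_forestP V F :
  decision_forest V F <->
  [/\ forall y, F y -> y `<=` V, rooted_forest F &
      set_bij V (maximal_chains F) (branch F)].
Proof.
split=> [[FV rF [f [bf fE]]]|[FV rF bij]].
  have [fS fI _] := bf.
  split=> //; apply: eq_set_bijRL bf => v; rewrite inE => Vv.
  apply/seteqP; split=> y.
    move=> fvy; have [[fvF _] _] := fS v Vv.
    have Fy := fvF _ fvy; split=> //.
    have [u yu fuv] : (f @` y) (f v) by rewrite fE //; split=> //; exact: fS.
    by have <- : u = v by apply: fI => //; rewrite inE //; exact: FV Fy _ yu.
  move=> [Fy yv]; have : (f @` y) (f v) by exists v.
  by rewrite fE// => -[].
have [fS _ fsurj] := bij.
split=> //; exists (branch F); split=> // y Fy; apply/seteqP; split.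
  by move=> _ [v yv <-]; split; [apply: fS; exact: (FV y) | split].
move=> w [mw wy]; have [v Vv vw] := fsurj w mw.
by exists v => //; move: wy; rewrite -vw => -[].
Qed.

(** A member of [F] containing [v] lies below the root of its own component. That root also contains
    [v], so by disjointness it is the root of [T], and the two components coincide. *)
Lemma branch_component F T v : rooted_forest F ->
  trivIset [set tree_root T | T in connected_components F] id ->
  connected_components F T -> tree_root T v -> branch F v = branch T v.
Proof.
move=> rF dF FT Rv; have [fF _ _] := rF.
apply/seteqP; split=> y [Fy yv]; split=> //; last exact: (component_sub fF FT).
have [T' FT' T'y] := ex_component fF Fy.
have [T'R T'leR] := tree_rootP rF FT'; have [TR _] := tree_rootP rF FT.
have RR : tree_root T' = tree_root T.
  apply: dF; [by exists T' | by exists T | exists v; split=> //].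
  exact: (T'leR y).
by rewrite RR in T'R; rewrite (component_uniq fF FT FT' TR T'R).
Qed.

End RootedForests.

Theorem theorem1p7 (U : Type) (V : set U) (F : set (set U))
    (FV : forall y, F y -> y `<=` V) (rF : rooted_forest F) :
  decision_forest V F <->
  partition [set tree_root T | T in connected_components F] id V /\
  (forall T : set (set U), connected_components F T -> decision_tree (tree_root T) T).
Proof.
have [fF _ _] := rF.
have rootF T : connected_components F T -> F (tree_root T).
  by move=> FT; apply: (component_sub fF FT); have [] := tree_rootP rF FT.
split=> [/decision_forestP[_ _ [bS bI bsurj]]|[[cV dV _] dT]].
  have part : partition [set tree_root T | T in connected_components F] id V.
    split.
    - apply/seteqP; split=> [v [_ [T FT <-]]|v Vv].
        by apply: FV; exact: rootF.
      have [T FT [_ Rv]] := ex_maximal_chain_root rF (bS v Vv).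
      by exists (tree_root T) => //; exists T.
    - move=> _ _ [T FT <-] [T' FT' <-] [v [Rv R'v]].
      (* The branch of a common point [v] is a chain containing both roots, which are thus
         comparable and lie in one component. *)
      have [[_ tb] _] := bS v (FV _ (rootF T FT) _ Rv).
      have [TR _] := tree_rootP rF FT; have [T'R _] := tree_rootP rF FT'.
      suff -> : T = T' by [].
      apply: (component_uniq fF FT FT' _ T'R).
      apply: (component_comparable fF FT TR (rootF _ FT')).
      by apply: tb; split=> //; exact: rootF.
    (* A maximal chain of [T] is a branch of [F] through the root; the point it comes from belongs
       to the root. *)
    - move=> _ [T FT <-]; have [w] := ex_maximal_chain T.
      rewrite (maximal_chains_component rF FT) => -[mw wR].
      by have [v _ vw] := bsurj w mw; move: wR; rewrite -vw => -[_]; exists v.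
  split=> // T FT; have [TR TleR] := tree_rootP rF FT.
  split; last by move=> x y /TleR xR /TleR yR; exists (tree_root T) => // v [/xR|/yR].
  have RV := FV _ (rootF T FT); have [_ dF _] := part.
  apply/decision_forestP; split=> //; first exact: component_rooted FT.
  (* With [branch F] in place of [branch T], bijectivity is inherited by restricting to the chains
     through the root. *)
  apply: (@eq_set_bijRL _ _ _ _ (branch F)).
    by move=> v; rewrite inE => Rv; exact: branch_component.
  rewrite (maximal_chains_component rF FT); split.
  - by move=> v Rv; split; [apply: bS; exact: RV | split=> //; exact: rootF].
  - by move=> u v; rewrite !inE => Ru Rv; apply: bI; rewrite inE; exact: RV.
  - move=> w [mw wR]; have [v _ vw] := bsurj w mw.
    by exists v => //; move: wR; rewrite -vw => -[].
apply/decision_forestP; split=> //; split.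
- move=> v; rewrite -{1}cV => -[_ [T FT <-] Rv].
  have [/decision_forestP[_ _ [bS _ _]] _] := dT T FT.
  rewrite (branch_component rF dV FT Rv).
  by have := bS v Rv; rewrite (maximal_chains_component rF FT) => -[].
- move=> u v; rewrite inE -{1}cV => -[_ [T FT <-] Ru] _ uv.
  (* Equal branches contain the same root, so [u] and [v] belong to one component's root and
     injectivity there suffices. *)
  have [_ Rv] : branch F v (tree_root T) by rewrite -uv; split=> //; exact: rootF.
  have [/decision_forestP[_ _ [_ bI _]] _] := dT T FT.
  by apply: bI; rewrite ?inE// -!(branch_component rF dV FT).
- move=> w mw; have [T FT wR] := ex_maximal_chain_root rF mw.
  have [/decision_forestP[_ _ [_ _ bsurj]] _] := dT T FT.
  have [|v Rv vw] := bsurj w; first by rewrite (maximal_chains_component rF FT).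
  exists v; first exact: FV (rootF T FT) _ Rv.
  by rewrite (branch_component rF dV FT Rv).
Qed.
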